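(* Fix $n \geq 2$. Then $\delta_n(k_0)$ is a perfect square for at most finitely many nonzero integers $k_0$.
   Context: The polynomials $\delta_n, \varepsilon_n \in \mathbb{Z}[k]$, $n \geq 1$, are defined by $(\delta_1(k),\varepsilon_1(k)) = (2k^2, k)$ and, for $n \geq 2$, $\delta_n(k) = \delta_{n-1}(k)^2 + \varepsilon_{n-1}(k)^2$, $\varepsilon_n(k) = \delta_{n-1}(k)\varepsilon_{n-1}(k)/k$. *)

(* Defs.v *)
From HB Require Import structures.
From mathcomp Require Import all_boot all_order all_algebra.
From mathcomp Require Import boolp classical_sets cardinality.
Set Implicit Arguments.
Unset Strict Implicit.
Unset Printing Implicit Defensive.
Import GRing.Theory.
Local Open Scope ring_scope.

(* [%/] on [{poly int}] is a pseudo-division in general; it is the genuine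
   Euclidean quotient here because the divisor ['X] is monic, and it is exact
   by [epsilonS] below. *)
Definition delta_epsilon_step (de : {poly int} * {poly int}) :
    {poly int} * {poly int} :=
  (de.1 ^+ 2 + de.2 ^+ 2, (de.1 * de.2) %/ 'X).

(* Indexing starts at 1; the value at index 0 is junk (it repeats index 1). *)
Definition delta_epsilon (n : nat) : {poly int} * {poly int} :=
  iter n.-1 delta_epsilon_step (2%:R *: 'X^2, 'X).

Definition delta (n : nat) : {poly int} := (delta_epsilon n).1.
Definition epsilon (n : nat) : {poly int} := (delta_epsilon n).2.

Definition perfect_square (a : int) : Prop := exists m : int, a = m ^+ 2.

Lemma delta1 : delta 1 = 2%:R *: 'X^2. Proof. by []. Qed.

Lemma epsilon1 : epsilon 1 = 'X. Proof. by []. Qed.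

Lemma deltaS (n : nat) : (0 < n)%N ->
  delta n.+1 = delta n ^+ 2 + epsilon n ^+ 2.
Proof. by case: n. Qed.

Lemma epsilon_divX (n : nat) : exists q, epsilon n = q * 'X.
Proof.
suff [] : (exists p, delta n = p * 'X) /\
    (exists q, epsilon n = q * 'X) by [].
rewrite /delta /epsilon /delta_epsilon; elim: n.-1 => [|m [[p Hp] [q Hq]]] /=.
  by split; [exists (2%:R *: 'X); rewrite -scalerAl | exists 1; rewrite mul1r].
rewrite Hp Hq; split.
  by exists (p ^+ 2 * 'X + q ^+ 2 * 'X); rewrite mulrDl !exprMn expr2 !mulrA.
exists (p * q).
by rewrite mulrA Pdiv.IdomainMonic.mulpK ?monicX// mulrAC.
Qed.

Lemma epsilonS (n : nat) : (0 < n)%N ->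
  epsilon n.+1 * 'X = delta n * epsilon n.
Proof.
case: n => // n _; have [q Hq] := epsilon_divX n.+1.
rewrite {1}/epsilon /= -/(delta n.+1) -/(epsilon n.+1) Hq.
by rewrite mulrA Pdiv.IdomainMonic.mulpK ?monicX.
Qed.

(* Main.v *)
(** Modulo 3 one has delta_n(1) = 2 for every n, so delta_n is not the square
    of a rational polynomial.  For n >= 2 it has even degree and square leading
    coefficient, so Runge's method applies: its truncated square root Q
    satisfies [size (delta_n - Q ^+ 2) < size Q], and for large [k0] the value
    delta_n(k0) lies, after clearing denominators, strictly between two
    consecutive squares. *)
Require Import Defs.
From mathcomp Require Import all_boot all_order all_algebra.
From mathcomp Require Import boolp classical_sets cardinality.
From mathcomp Require Import zify ring.
Import Order.TTheory GRing.Theory Num.Theory.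
Local Open Scope ring_scope.
Local Open Scope classical_set_scope.

Local Notation pZtoQ := (map_poly (intr : int -> rat)).

Lemma finite_set_int_bounded (A : set int) (B : int) :
  (forall k, A k -> `|k| <= B) -> finite_set A.
Proof.
move=> AB.
pose s := map Posz (iota 0 `|B|.+1); pose t := s ++ map -%R s.
apply: (@sub_finite_set _ _ [set` t]); last exact: finite_seq.
move=> k /AB kB; suff: k \in t by [].
rewrite mem_cat; apply/orP.
have ks : `|k| \in s by apply/mapP; exists `|k|%N; rewrite ?mem_iota; lia.
have [k0|k0] := leP 0 k; [left | right; apply/mapP; exists `|k|] => //.
  by rewrite -(ger0_norm k0).
by rewrite ltr0_norm ?opprK.
Qed.

Lemma horner_norm_le (p : {poly int}) (n : nat) (k : int) :
  (size p <= n.+1)%N -> 1 <= `|k| ->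
  `|p.[k]| <= (\sum_(i < n.+1) `|p`_i|) * `|k| ^+ n.
Proof.
move=> sp k1; rewrite (horner_coef_wide _ sp) mulr_suml.
apply: (le_trans (ler_norm_sum _ _ _)); apply: ler_sum => i _.
by rewrite normrM normrX ler_wpM2l // ler_weXn2l // -ltnS.
Qed.

(** A nonzero integer leading coefficient has absolute value at least 1, so the top term of [q]
    alone eventually dominates both its lower terms and [p]. *)
Lemma horner_norm_lt (p q : {poly int}) : (size p < size q)%N ->
  exists B : int, forall k, B < `|k| -> `|p.[k]| < `|q.[k]|.
Proof.
case sq: (size q) => [//|[|n]] spq.
  exists 0 => k _; have /eqP -> : p == 0 by rewrite -size_poly_eq0; lia.
  have /size_poly1P [c c0 ->] : size q == 1%N by rewrite sq.
  by rewrite horner0 hornerC normr0 normr_gt0.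
have lq : q`_n.+1 != 0.
  by rewrite -[n.+1]/(n.+2.-1) -sq -lead_coefE lead_coef_eq0 -size_poly_eq0 sq.
pose r := take_poly n.+1 q.
have qE : q = r + q`_n.+1 *: 'X^(n.+1).
  apply/polyP => i; rewrite coefD coefZ coefXn coef_take_poly.
  case: ltngtP => [|ni|->]; rewrite ?mulr0 ?mulr1 ?addr0 ?add0r //.
  by rewrite nth_default // sq.
set a := \sum_(i < n.+1) `|p`_i|; set b := \sum_(i < n.+1) `|r`_i|.
have a0 : 0 <= a by apply: sumr_ge0.
have b0 : 0 <= b by apply: sumr_ge0.
(* With [q] of degree [n + 1], [|q(k)| >= (|k| - b) * |k|^n], and this exceeds [a * |k|^n] once
   [|k| > a + b]. *)
exists (a + b) => k kB.
have k1 : 1 <= `|k| by lia.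
have pk : `|p.[k]| <= a * `|k| ^+ n by apply: horner_norm_le.
have rk : `|r.[k]| <= b * `|k| ^+ n.
  by apply: horner_norm_le => //; exact: size_take_poly.
have lk : `|k| ^+ n * `|k| <= `|q.[k]| + `|r.[k]|.
  have -> : q.[k] = r.[k] + q`_n.+1 * k ^+ n.+1 by rewrite {1}qE !hornerE.
  have := ler_normB (r.[k] + q`_n.+1 * k ^+ n.+1) r.[k].
  rewrite [_ + _ - _]addrC addKr normrM normrX; apply: le_trans.
  by rewrite -exprSr ler_peMl ?exprn_ge0 //; lia.
have kn : 0 < `|k| ^+ n by rewrite exprn_gt0 //; lia.
nia.
Qed.

(** The square root is extracted one coefficient at a time: [j] counts the coefficients fixed below
    the leading one. At [j = d] the remainder has size at most [d], less than [size Q]. *)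
Lemma poly_sqrt_approx (F : fieldType) (P : {poly F}) (d j : nat) (c : F) :
  2%:R != 0 :> F -> c != 0 -> size P = d.*2.+1 -> lead_coef P = c ^+ 2 ->
  (j <= d)%N ->
  exists Q : {poly F}, [/\ size Q = d.+1, lead_coef Q = c &
    (size (P - Q ^+ 2)%R <= d + (d - j))%N].
Proof.
move=> two c0 sP lP; elim: j => [_|j IH jd].
  have sQ : size (c *: 'X^d) = d.+1 by rewrite size_scale ?size_polyXn.
  exists (c *: 'X^d); split=> //; first by rewrite lead_coefZ lead_coefXn mulr1.
  apply/leq_sizeP => i di; rewrite coefB exprZn -exprM coefZ coefXn.
  have [->|ni] := eqVneq i (d * 2)%N.
    by rewrite mulr1 -lP lead_coefE sP muln2 subrr.
  by rewrite mulr0 subr0 nth_default // sP; lia.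
have [Q [sQ lQ sR]] := IH (ltnW jd).
(* The next coefficient to cancel is the one of degree [d + i] in [R]. The term [2 t Q] does this,
   as [Q] has degree [d] and leading coefficient [c]; [t ^+ 2] has degree at most [2 i < d + i] and
   does not interfere. *)
set R := P - Q ^+ 2 in sR; set i := (d - j.+1)%N.
have ij : (d - j = i.+1)%N by rewrite /i; lia.
pose t : {poly F} := (R`_(d + i) / (2%:R * c)) *: 'X^i.
have st : (size t <= d)%N.
  by rewrite (leq_trans (size_scale_leq _ _)) // size_polyXn /i; lia.
have stQ : (size t < size Q)%N by rewrite sQ.
exists (Q + t); split; [by rewrite size_polyDl | by rewrite lead_coefDl |].
have -> : P - (Q + t) ^+ 2 = R - 2%:R *: (t * Q) - t ^+ 2.
  by rewrite scaler_nat /R; ring.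
clearbody R.
apply/leq_sizeP => m dm; have im : (i <= m)%N by lia.
have -> : (R - 2%:R *: (t * Q) - t ^+ 2)`_m =
          R`_m - R`_(d + i) / c * Q`_(m - i) - (t ^+ 2)`_m.
  rewrite !coefB coefZ -scalerAl coefZ coefXnM ltnNge im /=.
  by field; rewrite two c0.
have -> : (t ^+ 2)`_m = 0.
  apply: nth_default; apply: leq_trans _ dm; rewrite exprZn -exprM.
  by rewrite (leq_trans (size_scale_leq _ _)) // size_polyXn /i; lia.
rewrite subr0.
have [md|mi] := eqVneq m (d + i)%N.
  rewrite md addnK; have -> : Q`_d = c by rewrite -lQ lead_coefE sQ.
  by rewrite divfK ?subrr.
have Rm : R`_m = 0 by apply: nth_default; apply: leq_trans sR _; lia.
have Qm : Q`_(m - i) = 0 by apply: nth_default; rewrite sQ; lia.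
by rewrite Rm Qm mulr0 subr0.
Qed.

Lemma runge_square_values (P : {poly int}) (d : nat) (c : int) :
  size P = d.*2.+1 -> lead_coef P = c ^+ 2 ->
  (forall Q : {poly rat}, pZtoQ P <> Q ^+ 2) ->
  finite_set [set k | perfect_square P.[k]].
Proof.
move=> sP lP nsq.
have inj : injective (intr : int -> rat) by exact: intr_inj.
have sQ (p : {poly int}) : size (pZtoQ p) = size p.
  exact: size_map_inj_poly.
have c0 : c != 0.
  by rewrite -sqrf_eq0 -lP lead_coef_eq0 -size_poly_eq0 sP.
have [||||//|Q [szQ lQ]] := poly_sqrt_approx rat (pZtoQ P) d d c%:~R.
- by [].
- by rewrite intr_eq0.
- by rewrite sQ.
- by rewrite lead_coef_map_inj // lP rmorphXn.
rewrite subnn addn0 => szR.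
(* Denominators are cleared: [Q] is [q / a] with [q] integral, and [r] is the remainder scaled by
   [a ^+ 2]. *)
have [q [a a0 Qq]] := rat_poly_scale Q.
have aQ0 : a%:~R != 0 :> rat by rewrite intr_eq0.
pose r := a ^+ 2 *: P - q ^+ 2.
have rE : pZtoQ r = a%:~R ^+ 2 *: (pZtoQ P - Q ^+ 2).
  rewrite rmorphB rmorphXn /= map_polyZ rmorphXn /= scalerBr; congr (_ - _).
  by rewrite Qq exprZn scalerA -exprMn divff // expr1n scale1r.
have szq : size q = d.+1.
  by rewrite -sQ -szQ Qq size_scale // invr_eq0.
have szr : (size r < size q)%N.
  by rewrite szq -(sQ r) rE size_scale ?expf_neq0.
have r0 : r != 0.
  apply: contra_notN (nsq Q) => /eqP r0; apply/eqP; rewrite -subr_eq0.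
  have /eqP := rE; rewrite r0 rmorph0 eq_sym scaler_eq0.
  by rewrite expf_eq0 (negbTE aQ0).
(* Beyond [B1], [|r(k)| < |q(k)|]; beyond [B2], [r(k)] is nonzero, by comparison with the zero
   polynomial. *)
have [B1 rq] := horner_norm_lt _ _ szr.
have [|B2 r_neq0] := horner_norm_lt 0 r.
  by rewrite size_poly0 size_poly_gt0.
apply: (finite_set_int_bounded _ (Num.max B1 B2)) => k [m Pk].
rewrite leNgt; apply/negP; rewrite gt_max => /andP[/rq kq /r_neq0].
have rk : r.[k] = (a * m) ^+ 2 - q.[k] ^+ 2 by rewrite !hornerE Pk; ring.
rewrite horner0 normr0; move: kq; rewrite rk; set x := a * m; set y := q.[k].
rewrite -(real_normK (num_real x)) -(real_normK (num_real y)).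
have := normr_ge0 x; have := normr_ge0 y; move: `|x| `|y| => u v v0 u0.
(* Distinct naturals [u] and [v] satisfy [|u^2 - v^2| >= v], against [|r(k)| < |q(k)|]; equality
   would give [r(k) = 0]. *)
have [uv|vu|->] := ltgtP u v; last by rewrite subrr normr0.
- have : u ^+ 2 - v ^+ 2 <= - v by nia.
  lia.
have : v <= u ^+ 2 - v ^+ 2 by nia.
lia.
Qed.

(** Squares are 0 or 1 modulo 3, so [2 t^2 = s^2] modulo 3 has only the zero solution. Explicit
    quotients leave [lia] a comparison of constants modulo 3 in each case. *)
Lemma sqr_eq_double_sqr_mod3 (w u v s t : int) :
  0 <= s < 3 -> 0 <= t < 3 ->
  (w * 3 + 2) * (v * 3 + t) ^+ 2 = (u * 3 + s) ^+ 2 -> s = 0 /\ t = 0.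
Proof.
move=> sb tb E.
have [s_val|[s_val|s_val]] : s = 0 \/ s = 1 \/ s = 2 by lia.
all: have [t_val|[t_val|t_val]] : t = 0 \/ t = 1 \/ t = 2 by lia.
all: rewrite {}s_val {}t_val {sb tb} in E *; lia.
Qed.

(** For [x = a / b] in lowest terms, [m b^2 = a^2] would force 3 to divide both [a] and [b]. *)
Lemma sqr_rat_mod3 (m : int) (x : rat) : (m %% 3 = 2)%Z -> m%:~R <> x ^+ 2.
Proof.
move=> m3 mx.
have E : m * denq x ^+ 2 = numq x ^+ 2.
  apply: (@intr_inj rat); rewrite rmorphM !rmorphXn /= mx -{1}(divq_num_den x).
  by field; rewrite intr_eq0 denq_neq0.
have := coprime_num_den x; move: E; set a := numq x; set b := denq x => E cab.
have [a3 b3] : (3 %| a)%Z /\ (3 %| b)%Z.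
  rewrite -!(rwP dvdz_mod0P).
  apply: (sqr_eq_double_sqr_mod3 (m %/ 3)%Z (a %/ 3)%Z (b %/ 3)%Z).
  - by rewrite modz_ge0 ?ltz_pmod.
  - by rewrite modz_ge0 ?ltz_pmod.
  have := divz_eq m 3; rewrite m3 => <-.
  by rewrite -!divz_eq.
have : (3 %| gcdn `|a|%N `|b|%N)%N by rewrite dvdn_gcd; apply/andP.
by rewrite (eqP cab).
Qed.

(** At 1 the division by ['X] disappears, and the pair of values evolves by
    [(x, y) -> (x^2 + y^2, x y)]. The condition on [y] carries the induction: [y^2 = 1] modulo 3, so
    [x^2 + y^2 = 4 + 1 = 2]. *)
Lemma delta_epsilon_at1_mod3 (n : nat) : (0 < n)%N ->
  ((delta n).[1] %% 3 = 2)%Z /\ ((epsilon n).[1] %% 3 <> 0)%Z.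
Proof.
case: n => // n _; elim: n => [|n [dn en]].
  by rewrite delta1 epsilon1 hornerZ hornerXn hornerX expr1n.
have -> : (epsilon n.+2).[1] = (delta n.+1).[1] * (epsilon n.+1).[1].
  by rewrite -hornerM -epsilonS // hornerM hornerX mulr1.
rewrite deltaS // hornerD !horner_exp.
move: (delta _).[1] (epsilon _).[1] dn en => x y x2 y0.
have -> : (x ^+ 2 + y ^+ 2)%R = x * x + y * y by rewrite !expr2.
have [u xE] : exists u, x = 3 * u + 2 by exists (x %/ 3)%Z; lia.
have [v yE] : exists v, y = 3 * v + 1 \/ y = 3 * v + 2.
  by exists (y %/ 3)%Z; lia.
by rewrite {}xE in x2 *; case: yE => ->; split; lia.
Qed.

Lemma size_poly_sqr (R : idomainType) (p : {poly R}) : p != 0 ->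
  size (p ^+ 2) = (size p).-1.*2.+1.
Proof. by move=> p0; rewrite (polySpred (expf_neq0 2 p0)) size_exp muln2. Qed.

Lemma size_epsilon_sqr_lt (n : nat) :
  size (delta n) = (2 ^ n).+1 -> (size (epsilon n) <= 2 ^ n)%N ->
  (size (epsilon n ^+ 2)%R < size (delta n ^+ 2)%R)%N.
Proof.
move=> dn en; have d0 : delta n != 0 by rewrite -size_poly_eq0 dn.
rewrite (size_poly_sqr _ _ d0) dn /=.
apply: leq_ltn_trans (size_poly_exp_leq _ _) _.
have : (0 < 2 ^ n)%N by rewrite expn_gt0.
move: (size _) (2 ^ n)%N en => i j; lia.
Qed.

(** The two claims are proved together: the bound on [epsilon] keeps its square below the leading
    term of [delta n ^+ 2]. *)
Lemma size_delta_epsilon (n : nat) : (0 < n)%N ->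
  size (delta n) = (2 ^ n).+1 /\ (size (epsilon n) <= 2 ^ n)%N.
Proof.
case: n => // n _; elim: n => [|n [dn en]].
  by rewrite delta1 epsilon1 size_scale // size_polyXn size_polyX.
have d0 : delta n.+1 != 0 by rewrite -size_poly_eq0 dn.
split.
  rewrite deltaS // size_polyDl ?size_epsilon_sqr_lt //.
  by rewrite (size_poly_sqr _ _ d0) dn /= -mul2n -expnS.
have [->|e0] := eqVneq (epsilon n.+2) 0; first by rewrite size_poly0.
rewrite -ltnS -(size_mulX e0) epsilonS //.
apply: leq_trans (size_polyMleq _ _) _; rewrite dn.
rewrite [(2 ^ n.+2)%N]expnS; move: (size _) (2 ^ n.+1)%N en => i j; lia.
Qed.

(** This supplies the square leading coefficient for Runge's method from index 2 on; [delta 1] has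
    leading coefficient 2. *)
Lemma lead_coef_deltaS (n : nat) : (0 < n)%N ->
  lead_coef (delta n.+1) = lead_coef (delta n) ^+ 2.
Proof.
move=> n0; have [dn en] := size_delta_epsilon _ n0.
by rewrite deltaS // lead_coefDl ?lead_coef_exp // size_epsilon_sqr_lt.
Qed.

Theorem theorem24 (n : nat) (hn : (2 <= n)%N) :
  finite_set [set k0 : int | k0 <> 0 /\ perfect_square (delta n).[k0]].
Proof.
case: n hn => [|n] // n0; have [sd _] := size_delta_epsilon _ (ltn0Sn n).
apply: (@sub_finite_set _ _ [set k | perfect_square (delta n.+1).[k]]).
  by move=> k [].
apply: (runge_square_values _ (2 ^ n) _ _ (lead_coef_deltaS _ n0)).
  by rewrite sd expnS mul2n.
(* A polynomial square root [Q] would make the integer [delta n.+1] at 1, which is 2 modulo 3, the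
   square of the rational [Q.[1]]. *)
move=> Q PQ; have [d3 _] := delta_epsilon_at1_mod3 _ (ltn0Sn n).
apply: (sqr_rat_mod3 _ Q.[1] d3).
by rewrite -horner_exp -PQ -horner_map rmorph1.
Qed.
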